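(* Fix $u\in\mathbb Z^2$ and $0<\rho<1$, and let $\{\omega_x, I_{u+ie_1}, J_{u+je_2}: x\in u+\mathbb Z_{>0}^2,\ i,j\in\mathbb Z_{>0}\}$ be mutually independent random variables with $\omega_x\sim\mathrm{Exp}(1)$, $I_{u+ie_1}\sim\mathrm{Exp}(1-\rho)$, $J_{u+je_2}\sim\mathrm{Exp}(\rho)$. Define further variables inductively, for all $x\in u+\mathbb Z_{>0}^2$, by $$\check\omega_{x-e_1-e_2}=I_{x-e_2}\wedge J_{x-e_1},\quad I_x=\omega_x+(I_{x-e_2}-J_{x-e_1})^+,\quad J_x=\omega_x+(I_{x-e_2}-J_{x-e_1})^-.$$ Then: (i) For any down-right path $\mathcal Y=(y_k)_{k\in\mathbb Z}$ in $u+\mathbb Z_{\ge0}^2$, the random variables $$\{\check\omega_z,\ t(\{y_{k-1},y_k\}),\ \omega_x:\ z\in\mathcal G_-,\ k\in\mathbb Z,\ x\in\mathcal G_+\}$$ are mutually independent, with marginal distributions $\omega_x,\check\omega_x\sim\mathrm{Exp}(1)$, $I_x\sim\mathrm{Exp}(1-\rho)$, $J_x\sim\mathrm{Exp}(\rho)$. (ii) $I_x=G^\rho_{u,x}-G^\rho_{u,x-e_1}$ for $x\in u+\mathbb Z_{>0}\times\mathbb Z_{\ge0}$, and $J_x=G^\rho_{u,x}-G^\rho_{u,x-e_2}$ for $x\in u+\mathbb Z_{\ge0}\times\mathbb Z_{>0}$.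
   Context: $e_1=(1,0)$, $e_2=(0,1)$; $\mathrm{Exp}(\lambda)$ is the exponential distribution with rate $\lambda$; $a\wedge b=\min$, $a\vee b=\max$, $a^+=a\vee0$, $a^-=(-a)\vee0$. A down-right path in $u+\mathbb Z_{\ge0}^2$ is a bi-infinite sequence $\mathcal Y=(y_k)_{k\in\mathbb Z}$ in $u+\mathbb Z_{\ge0}^2$ with $y_k-y_{k-1}\in\{e_1,-e_2\}$ for all $k$. Set $\mathcal G_-=\{x\in u+\mathbb Z_{\ge0}^2:\exists j\in\mathbb Z_{>0},\ x+(j,j)\in\mathcal Y\}$ and $\mathcal G_+=\{x\in u+\mathbb Z_{\ge0}^2:\exists j\in\mathbb Z_{>0},\ x-(j,j)\in\mathcal Y\}$. For an undirected nearest-neighbor edge $e$, $t(e)=I_x$ if $e=\{x-e_1,x\}$ and $t(e)=J_x$ if $e=\{x-e_2,x\}$. The last-passage process $G^\rho_{u,x}$, $x\in u+\mathbb Z_{\ge0}^2$, is defined by $G^\rho_{u,u}=0$, $G^\rho_{u,u+me_1}=\sum_{i=1}^m I_{u+ie_1}$, $G^\rho_{u,u+ne_2}=\sum_{j=1}^nJ_{u+je_2}$, and $G^\rho_{u,x}=\omega_x+G^\rho_{u,x-e_1}\vee G^\rho_{u,x-e_2}$ for $x\in u+\mathbb Z_{>0}^2$. *)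

(* Defs.v *)
From HB Require Import structures.
From mathcomp Require Import all_boot all_order all_algebra.
From mathcomp Require Import finmap zify.
From mathcomp Require Import all_classical all_reals all_analysis.

Set Implicit Arguments.
Unset Strict Implicit.
Unset Printing Implicit Defensive.

Import Order.TTheory GRing.Theory Num.Theory.
Import numFieldNormedType.Exports.

Local Open Scope classical_set_scope.
Local Open Scope ring_scope.

Notation site := (int * int)%type.

Definition e1 : site := (1, 0).
Definition e2 : site := (0, 1).

(* u + Z_{>=0}^2 *)
Definition quadrant_ge (u : site) : set site :=
  [set x | u.1 <= x.1 /\ u.2 <= x.2].

(* u + Z_{>0}^2 *)
Definition quadrant_gt (u : site) : set site :=
  [set x | u.1 < x.1 /\ u.2 < x.2].

Section probability.
Context d (T : measurableType d) (R : realType) (P : probability T R).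

(* The family (X k)_{k in D} is a mutually independent family of real random
   variables; the values of X outside D are irrelevant. *)
Definition mutually_independent (K : choiceType) (D : set K)
    (X : K -> T -> R) : Prop :=
  (forall k, D k -> measurable_fun [set: T] (X k)) /\
  forall (F : {fset K}) (A : K -> set R),
    [set` F] `<=` D -> (forall k, k \in F -> measurable (A k)) ->
    P (\bigcap_(k in [set` F]) (X k @^-1` A k)) =
    (\prod_(k <- F) P (X k @^-1` A k))%E.

(* exponential_prob is only meant on measurable sets. *)
Definition exp_distributed (X : T -> R) (lambda : R) : Prop :=
  measurable_fun [set: T] X /\
  forall A : set R, measurable A ->
    pushforward P X A = exponential_prob lambda A.

End probability.

Section lattice.
Context (T : Type) (R : realType).
Implicit Types omega comega I J G : site -> T -> R.

(* inl x, inr (inl i), inr (inr j) encode omega_x, I_{u + i e1} and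
   J_{u + j e2}. *)
Definition input_index (u : site) : set (site + (nat + nat))%type :=
  [set k | match k with
           | inl x => quadrant_gt u x
           | inr (inl i) => (0 < i)%N
           | inr (inr j) => (0 < j)%N
           end].

Definition input_var omega I J (u : site) (k : site + (nat + nat)) : T -> R :=
  match k with
  | inl x => omega x
  | inr (inl i) => I (u + e1 *+ i)
  | inr (inr j) => J (u + e2 *+ j)
  end.

(* On u + Z_{>=0}^2 the equations determine comega, I and J from omega and
   from the values of I and J on the two axes. *)
Record increment_recursion (u : site) omega I J comega : Prop := {
  comega_rec : forall x, quadrant_gt u x -> forall t,
    comega (x - e1 - e2) t = Num.min (I (x - e2) t) (J (x - e1) t);
  I_rec : forall x, quadrant_gt u x -> forall t,
    I x t = omega x t + Num.max (I (x - e2) t - J (x - e1) t) 0;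
  J_rec : forall x, quadrant_gt u x -> forall t,
    J x t = omega x t + Num.max (- (I (x - e2) t - J (x - e1) t)) 0
}.

(* These equations determine G on u + Z_{>=0}^2. *)
Record last_passage (u : site) omega I J G : Prop := {
  lp_origin : forall t, G u t = 0;
  lp_axis1 : forall (m : nat) t,
    G (u + e1 *+ m) t = \sum_(1 <= i < m.+1) I (u + e1 *+ i) t;
  lp_axis2 : forall (n : nat) t,
    G (u + e2 *+ n) t = \sum_(1 <= j < n.+1) J (u + e2 *+ j) t;
  lp_bulk : forall x, quadrant_gt u x -> forall t,
    G x t = omega x t + Num.max (G (x - e1) t) (G (x - e2) t)
}.

Definition down_right_path (u : site) (y : int -> site) : Prop :=
  forall k : int,
    quadrant_ge u (y k) /\ (y k - y (k - 1) = e1 \/ y k - y (k - 1) = - e2).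

Definition below_path (u : site) (y : int -> site) : set site :=
  [set x | quadrant_ge u x /\
    exists j : nat, (0 < j)%N /\ range y (x + (e1 + e2) *+ j)].

Definition above_path (u : site) (y : int -> site) : set site :=
  [set x | quadrant_ge u x /\
    exists j : nat, (0 < j)%N /\ range y (x - (e1 + e2) *+ j)].

(* t({a, b}) for the undirected edge {a, b}; zero if a and b are not nearest
   neighbours. *)
Definition edge_var I J (a b : site) : T -> R :=
  if b == a + e1 then I b
  else if a == b + e1 then I a
  else if b == a + e2 then J b
  else if a == b + e2 then J a
  else fun=> 0.

Lemma edge_varC I J (a b : site) : edge_var I J a b = edge_var I J b a.
Proof.
case: a b => [a1 a2] [b1 b2]; rewrite /edge_var !xpair_eqE /=.
by do 4?[case: ifP => /= [/andP[/eqP ? /eqP ?]|_]]; subst => //; exfalso; lia.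
Qed.

(* inl z, inr (inl k), inr (inr x) encode comega_z with z below the path,
   the variable of the k-th edge of the path, and omega_x with x above it. *)
Definition path_index (u : site) (y : int -> site) :
    set (site + (int + site))%type :=
  [set k | match k with
           | inl z => below_path u y z
           | inr (inl _) => True
           | inr (inr x) => above_path u y x
           end].

Definition path_var omega I J comega (y : int -> site)
    (k : site + (int + site)) : T -> R :=
  match k with
  | inl z => comega z
  | inr (inl k) => edge_var I J (y (k - 1)) (y k)
  | inr (inr x) => omega x
  end.

End lattice.

(* Main.v *)
Require Import Defs.
From HB Require Import structures.
From mathcomp Require Import all_boot all_order all_algebra.
From mathcomp Require Import finmap zify lra.
From mathcomp Require Import all_classical all_reals all_analysis.
From mathcomp Require Import measurable_realfun.

Set Implicit Arguments.
Unset Strict Implicit.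
Unset Printing Implicit Defensive.

Import Order.TTheory GRing.Theory Num.Theory.
Import numFieldNormedType.Exports.

Local Open Scope classical_set_scope.
Local Open Scope ring_scope.

(* If W, I, J are independent with laws Exp(1), Exp(1 - rho), Exp(rho), then
   memorylessness makes M = min(I, J) an Exp(1) variable independent of
   D = I - J. Hence (W, M, D) and (M, W, D) have the same law, and applying
   (w, m, d) |-> (w, m + d^+, m + d^-) to both shows that the corner update
   (M, W + D^+, W + D^-) has the law of (W, I, J). Starting from the axes, one
   adds the unit squares of a finite Young diagram one at a time; each step is
   a corner update of three members of an independent family, so the variables
   attached to the boundary, the interior and the exterior of the diagram remain
   independent. A bi-infinite path may enclose infinitely many squares, but any
   finite set of its variables already occurs along the boundary of the diagram
   obtained by cutting the region below the path with a large square. *)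

(** * Uniqueness of finite measures from a generating pi-system *)

Section restricted_laws.
Context d (T : measurableType d) (R : realType) (P : probability T R).
Implicit Types E : set T.

Lemma measurable_preimage d' (S : measurableType d') (U : T -> S) A :
  measurable_fun [set: T] U -> measurable A -> measurable (U @^-1` A).
Proof. by move=> mU mA; rewrite -[_ @^-1` _]setTI; exact: mU. Qed.

(** Both sides are finite measures in [A], and finite measures agreeing on a generating pi-system
    that covers the space coincide. The events [E1], [E2] and the weight [c] let one statement serve
    for independence and for memorylessness. *)
Lemma eq_restricted_law d' (S : measurableType d') (G : set (set S))
    (g : (set S)^nat) (c : {nonneg R}) (E1 E2 : set T) (U1 U2 : T -> S) :
  measurable = <<s G >> -> setI_closed G -> (forall i, G (g i)) ->
  \bigcup_k g k = [set: S] -> measurable E1 -> measurable E2 ->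
  measurable_fun [set: T] U1 -> measurable_fun [set: T] U2 ->
  (forall A, G A ->
     P (E1 `&` U1 @^-1` A) = (c%:num%:E * P (E2 `&` U2 @^-1` A))%E) ->
  forall A, measurable A ->
     P (E1 `&` U1 @^-1` A) = (c%:num%:E * P (E2 `&` U2 @^-1` A))%E.
Proof.
move=> GE GI Gg gT mE1 mE2 mU1 mU2 H A mA.
pose P1 := mrestr P mE1; pose P2 := mscale c (mrestr P mE2).
pose m1 := pushforward P1 U1.
pose m2 := pushforward P2 U2.
have fin1 k : (m1 (g k) < +oo)%E.
  rewrite /m1 /pushforward /P1 /mrestr.
  apply: (@le_lt_trans _ _ 1%E); last exact: ltry.
  apply: probability_le1; apply: measurableI => //.
  apply: measurable_preimage => //.
  by rewrite GE; exact: sub_sigma_algebra.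
have mE : forall B, m1 B = P (E1 `&` U1 @^-1` B) by move=> B; rewrite setIC.
have mE2' : forall B, m2 B = (c%:num%:E * P (E2 `&` U2 @^-1` B))%E.
  by move=> B; rewrite setIC.
rewrite -mE -mE2'.
apply: (measure_unique G g GE GI Gg gT
  (measure_function_pushforward__canonical__measure_function_Measure P1 mU1)
  (measure_function_pushforward__canonical__measure_function_Measure P2 mU2)) => //.
by move=> B GB; rewrite /= -/m1 -/m2 mE mE2' H.
Qed.

Lemma eq_restricted_law_tails (c : {nonneg R}) (E1 E2 : set T)
    (U1 U2 : T -> R) :
  measurable E1 -> measurable E2 ->
  measurable_fun [set: T] U1 -> measurable_fun [set: T] U2 ->
  (forall s, P (E1 `&` [set t | s < U1 t]) =
             (c%:num%:E * P (E2 `&` [set t | (s < U2 t)%R]))%E) ->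
  forall A : set R, measurable A ->
     P (E1 `&` U1 @^-1` A) = (c%:num%:E * P (E2 `&` U2 @^-1` A))%E.
Proof.
move=> mE1 mE2 mU1 mU2 H.
have tailE U s : U @^-1` `]s, +oo[ = [set t | s < U t] :> set T.
  by apply/seteqP; split => t /=; rewrite in_itv/= andbT.
apply: (@eq_restricted_law _ _ (@RGenOInfty.G R)
   (fun n => `](- n%:R)%R, +oo[%classic)) => //.
- exact: RGenOInfty.measurableE.
- move=> _ _ [x ->] [y ->]; exists (Num.max x y).
  apply/seteqP; split => z /=; rewrite !in_itv/= !andbT.
    by move=> [xz yz]; rewrite gt_max xz.
  by rewrite gt_max => /andP.
- by move=> i; exists (- i%:R).
- apply/seteqP; split => // x _; exists (Num.truncn `|x|).+1 => //=.
  rewrite in_itv/= andbT ltrNl (le_lt_trans (ler_norm _))// normrN.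
  by rewrite truncnS_gt.
- by move=> _ [s ->]; rewrite !tailE.
Qed.

Lemma eq_restricted_law_prod d1 d2 (S1 : measurableType d1)
    (S2 : measurableType d2) (c : {nonneg R}) (E1 E2 : set T)
    (U1 U2 : T -> S1) (V1 V2 : T -> S2) :
  measurable E1 -> measurable E2 ->
  measurable_fun [set: T] U1 -> measurable_fun [set: T] U2 ->
  measurable_fun [set: T] V1 -> measurable_fun [set: T] V2 ->
  (forall A B, measurable A -> measurable B ->
     P (E1 `&` (U1 @^-1` A `&` V1 @^-1` B)) =
     (c%:num%:E * P (E2 `&` (U2 @^-1` A `&` V2 @^-1` B)))%E) ->
  forall C : set (S1 * S2), measurable C ->
     P (E1 `&` [set t | C (U1 t, V1 t)]) =
     (c%:num%:E * P (E2 `&` [set t | C (U2 t, V2 t)]))%E.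
Proof.
move=> mE1 mE2 mU1 mU2 mV1 mV2 H.
apply: (@eq_restricted_law _ _
   [set A `*` B | A in measurable & B in measurable] (fun=> setT)) => //.
- exact: measurable_prod_measurableType.
- move=> _ _ [A1 mA1 [B1 mB1 <-]] [A2 mA2 [B2 mB2 <-]].
  exists (A1 `&` A2); first exact: measurableI.
  by exists (B1 `&` B2); [exact: measurableI|rewrite setXI].
- by move=> i; exists setT => //; exists setT => //; rewrite setXTT.
- by apply/seteqP; split => // x _; exists 0%N.
- exact: measurable_fun_pair.
- exact: measurable_fun_pair.
- by move=> _ [A mA [B mB <-]]; exact: H.
Qed.

End restricted_laws.

(** * Tails and memorylessness of the exponential law *)

Section exponential.
Context d (T : measurableType d) (R : realType) (P : probability T R).
Implicit Types X : T -> R.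

Lemma exponential_prob_restrict (lambda : R) (A : set R) :
  exponential_prob lambda A = exponential_prob lambda (A `&` `[0, +oo[).
Proof.
rewrite /exponential_prob integral_mkcondr; apply: eq_integral => x _.
by rewrite /exponential_pdf !patchE; case: ifP.
Qed.

Lemma exp_distributed_tail X (lambda : R) s :
  exp_distributed P X lambda ->
  P [set t | s < X t] = (expR (- lambda * Num.max s 0))%:E.
Proof.
move=> [mX XE].
have -> : [set t | s < X t] = ~` (X @^-1` `]-oo, s]).
  by apply/seteqP; split => t /=; rewrite in_itv/= ltNge => /negP.
rewrite probability_setC; last exact: measurable_preimage.
rewrite -[X in (1 - X)%E]/(pushforward P X _) XE// exponential_prob_restrict.
have [s0|s0] := ltP 0 s.
  have -> : `]-oo, s] `&` `[0, +oo[ = `[0, s]%classic.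
    by apply/seteqP; split => x /=; rewrite !in_itv/= andbT;
      [move=> [-> ->]|move=> /andP[-> ->]].
  by rewrite exponential_prob_itv0c// -!EFinD; congr _%:E; lra.
rewrite mulr0 expR0 [X in (_ - X)%E](_ : _ = 0%E) ?sube0//.
(* For [s = 0] the intersection is one point, null because the law has a density; for [s < 0] it is
   empty. *)
have [s00|s1] := eqVneq s 0.
  have -> : `]-oo, s] `&` `[0, +oo[ = [set 0 : R].
    apply/seteqP; split => x /=; rewrite s00 !in_itv/= ?andbT.
      by move=> [x0 x1]; apply/eqP; rewrite eq_le x0.
    by move=> ->.
  by rewrite /exponential_prob integral_set1.
have -> : `]-oo, s] `&` `[0, +oo[ = set0 :> set R.
  apply/seteqP; split => x //=; rewrite !in_itv/= ?andbT => -[xs x0].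
  have := le_trans x0 xs; have : s < 0 by rewrite lt_neqAle s1.
  lra.
by rewrite /exponential_prob integral_set0.
Qed.

(** Exceeding both [s] and [s + r] is the tail event at [s + max(r, 0)], whose probability splits as
    a product of exponentials; tails determine the law. *)
Lemma exp_distributed_memoryless X (lambda s : R) (A : set R) : 0 <= s ->
  exp_distributed P X lambda -> measurable A ->
  P ([set t | s < X t] `&` (fun t => X t - s) @^-1` A) =
  ((expR (- lambda * s))%:E * P (X @^-1` A))%E.
Proof.
move=> s0 XE mA; have [mX _] := XE.
have -> : P (X @^-1` A) = P (setT `&` X @^-1` A) by rewrite setTI.
apply: (@eq_restricted_law_tails _ _ _ _
  (NngNum (expR_ge0 (- lambda * s)))) => //.
- by have := measurable_preimage mX (measurable_itv `]s, +oo[); congr measurable;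
    apply/seteqP; split => t /=; rewrite in_itv/= andbT.
- exact: measurable_funB.
move=> r; rewrite setTI (exp_distributed_tail _ XE).
have -> : [set t | s < X t] `&` [set t | r < X t - s] =
          [set t | s + Num.max r 0 < X t].
  apply/seteqP; split => t /=; rewrite -[_ + Num.max _ _ < _]ltrBrDl gt_max.
    by move=> [h1 h2]; rewrite h2 subr_gt0.
  by move=> /andP[h1 h2]; rewrite -subr_gt0.
rewrite (exp_distributed_tail _ XE) /= -EFinM -expRD; congr (expR _)%:E.
rewrite [Num.max (s + _) 0]max_l; last by rewrite addr_ge0// le_max lexx orbT.
by rewrite mulrDr.
Qed.

Lemma exp_distributed_tail_le0 X (lambda s : R) : s <= 0 ->
  exp_distributed P X lambda -> P [set t | s < X t] = 1%E.
Proof. by move=> s0 /exp_distributed_tail ->; rewrite max_r// mulr0 expR0. Qed.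

End exponential.

(** * The update of a single unit square *)

Section corner.
Context d (T : measurableType d) (R : realType) (P : probability T R).
Implicit Types W I J : T -> R.

Lemma measurable_tail X s : measurable_fun [set: T] X ->
  measurable [set t | s < X t :> R].
Proof.
move=> mX; have -> : [set t | s < X t] = X @^-1` `]s, +oo[.
  by apply/seteqP; split => t /=; rewrite in_itv/= andbT.
exact: measurable_preimage.
Qed.

Lemma probability_setI_full (A B : set T) : measurable A -> measurable B ->
  P B = 1%E -> P (A `&` B) = P A.
Proof.
move=> mA mB B1; apply/eqP; rewrite eq_le; apply/andP; split.
  by rewrite le_measure ?inE//; exact: measurableI.
have <- : (P (A `&` B) + P (~` B))%E = P (A `&` B).
  by rewrite probability_setC// B1 subee// adde0.
rewrite (le_trans _ (measureU2 _ _ _))//; last 2 first.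
- exact: measurableI.
- exact: measurableC.
rewrite le_measure ?inE//.
  by apply: measurableU; [exact: measurableI|exact: measurableC].
by move=> t At; have [Bt|Bt] := pselect (B t); [left|right].
Qed.

(* Shifting by s on {I > s, J > s} preserves I - J, and by memorylessness
   multiplies the joint law of (I, J) by exp (- (a + b) s). *)
Lemma min_diff_independent W I J (a b : R) (A C : set R) :
  exp_distributed P W (a + b) -> exp_distributed P I a ->
  exp_distributed P J b ->
  (forall B D, measurable B -> measurable D ->
    P (I @^-1` B `&` J @^-1` D) = (P (I @^-1` B) * P (J @^-1` D))%E) ->
  measurable A -> measurable C ->
  P ((fun t => I t - J t) @^-1` C `&` (fun t => Num.min (I t) (J t)) @^-1` A) =
  (P ((fun t => I t - J t)%R @^-1` C) * P (W @^-1` A))%E.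
Proof.
move=> EW EI EJ indep mA mC.
have [[[mW _] [mI _]] [mJ _]] := (EW, EI, EJ).
have mD : measurable_fun [set: T] (fun t => I t - J t) by exact: measurable_funB.
have mDC := measurable_preimage mD mC.
have PDC : P ((fun t => I t - J t) @^-1` C) \is a fin_num.
  exact: fin_num_measure.
rewrite -[in RHS](fineK PDC) -[W @^-1` A]setTI.
apply: (@eq_restricted_law_tails _ _ _ _
  (NngNum (fine_ge0 (measure_ge0 P ((fun t => I t - J t) @^-1` C))))) => //.
  exact: measurable_minr.
move=> s; rewrite setTI/= fineK//.
have minE : [set t | s < Num.min (I t) (J t)] =
            [set t | s < I t] `&` [set t | s < J t].
  by apply/seteqP; split => t /=; rewrite lt_min => /andP.
have mIs := measurable_tail s mI.
have mJs := measurable_tail s mJ.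
rewrite minE.
(* For [s <= 0] all tails involved have probability one; the shift argument is needed only for
   [s > 0]. *)
have [s0|s0] := leP s 0.
  rewrite (exp_distributed_tail_le0 s0 EW) mule1 probability_setI_full//.
    exact: measurableI.
  by rewrite probability_setI_full//;
    [exact: (exp_distributed_tail_le0 s0 EI)|
     exact: (exp_distributed_tail_le0 s0 EJ)].
rewrite setIC (exp_distributed_tail _ EW) muleC max_l ?ltW//.
have -> : (fun t => I t - J t) @^-1` C =
   setT `&` [set t | [set z : R * R | C (z.1 - z.2)] (I t, J t)].
  by rewrite setTI.
have -> : [set t | s < I t] `&` [set t | s < J t] `&`
   (setT `&` [set t | [set z : R * R | C (z.1 - z.2)] (I t, J t)]) =
   ([set t | s < I t] `&` [set t | s < J t]) `&`
   [set t | [set z : R * R | C (z.1 - z.2)] (I t - s, J t - s)].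
  rewrite setTI; congr (_ `&` _); apply/seteqP; split => t /=;
   by rewrite (_ : I t - s - (J t - s) = I t - J t)//; lra.
apply: (@eq_restricted_law_prod _ _ _ _ _ _ _ _
  (NngNum (expR_ge0 (- (a + b) * s)))) => //.
- exact: measurableI.
- exact: measurable_funB.
- exact: measurable_funB.
- move=> B D mB mD'; rewrite setTI/= setIACA.
  have shiftE X (F : set R) : [set t | s < X t] `&` (fun t => X t - s) @^-1` F =
     X @^-1` (`]s, +oo[ `&` (fun x => x - s) @^-1` F) :> set T.
    by apply/seteqP; split => t /=; rewrite in_itv/= andbT.
  have mshift F : measurable F ->
      measurable (`]s, +oo[ `&` (fun x : R => x - s) @^-1` F).
    move=> mF; apply: measurableI => //; apply: (measurable_preimage _ mF).
    exact: measurable_funB.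
  rewrite [in LHS]shiftE [X in _ `&` X]shiftE.
  rewrite (indep _ _ (mshift _ mB) (mshift _ mD')).
  rewrite -!shiftE (exp_distributed_memoryless (ltW s0) EI)//.
  rewrite (exp_distributed_memoryless (ltW s0) EJ)// indep// muleACA.
  rewrite -EFinM -expRD.
  by congr ((expR _)%:E * _)%E; lra.
- rewrite -[X in measurable X]/((fun z : R * R => z.1 - z.2) @^-1` C).
  apply: (measurable_preimage _ mC); apply: measurable_funB.
    exact: measurable_fst.
  exact: measurable_snd.
Qed.

(** The event [E] stands for conditions on the rest of the independent family, so that one identity
    gives both the new joint law and its independence from everything else. *)
Lemma corner_update (E : set T) W I J (a b : R) (A B C : set R) :
  measurable E -> exp_distributed P W (a + b) -> exp_distributed P I a ->
  exp_distributed P J b ->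
  (forall A B, measurable A -> measurable B ->
    P (I @^-1` A `&` J @^-1` B) = (P (I @^-1` A) * P (J @^-1` B))%E) ->
  (forall A B C, measurable A -> measurable B -> measurable C ->
    P ((E `&` W @^-1` A) `&` (I @^-1` B `&` J @^-1` C)) =
    (P E * P (W @^-1` A) * (P (I @^-1` B) * P (J @^-1` C)))%E) ->
  measurable A -> measurable B -> measurable C ->
  P ((E `&` [set t | A (Num.min (I t) (J t))]) `&`
     ([set t | B (W t + Num.max (I t - J t) 0)] `&`
      [set t | C (W t + Num.max (- (I t - J t)) 0)])) =
  (P E * P (W @^-1` A) * (P (I @^-1` B) * P (J @^-1` C)))%E.
Proof.
move=> mE EW EI EJ indep indepE mA mB mC.
have [[[mW _] [mI _]] [mJ _]] := (EW, EI, EJ).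
pose D t := I t - J t; pose M t := Num.min (I t) (J t).
have mD : measurable_fun [set: T] D by exact: measurable_funB.
have mM : measurable_fun [set: T] M by exact: measurable_minr.
have mpre (X : T -> R) F : measurable_fun [set: T] X -> measurable F ->
  measurable (X @^-1` F) := @measurable_preimage _ _ _ _ X F.
have c_fin F : measurable F -> (P E * P (W @^-1` F))%E \is a fin_num.
  by move=> mF; rewrite fin_numM ?fin_num_measure//; exact: mpre.
have c_ge0 F : 0 <= fine (P E * P (W @^-1` F)) by rewrite fine_ge0 ?mule_ge0.
(* Independence is extended from rectangles to all events of [(I, J)], since [M] and [D] mix the two
   variables. *)
have indep_joint F (Q : set (R * R)) : measurable F -> measurable Q ->
    P ((E `&` W @^-1` F) `&` [set t | Q (I t, J t)]) =
    (P E * P (W @^-1` F) * P [set t | Q (I t, J t)])%E.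
  move=> mF mQ; rewrite -[in RHS](fineK (c_fin _ mF)).
  rewrite -[X in (_ * P X)%E]setTI.
  apply: (@eq_restricted_law_prod _ _ _ _ _ _ _ _ (NngNum (c_ge0 F))) => //.
    by apply: measurableI => //; exact: mpre.
  move=> F1 F2 mF1 mF2; rewrite /= fineK ?c_fin// setTI indep//.
  exact: indepE.
have indep_WMD F F1 F2 : measurable F -> measurable F1 -> measurable F2 ->
    P ((E `&` W @^-1` F) `&` (M @^-1` F1 `&` D @^-1` F2)) =
    (P E * P (W @^-1` F) * (P (W @^-1` F1) * P (D @^-1` F2)))%E.
  move=> mF mF1 mF2.
  rewrite [(P (W @^-1` F1) * _)%E]muleC.
  rewrite -(min_diff_independent EW EI EJ indep mF1 mF2) -/D -/M.
  have mQ : measurable ((fun z : R * R => Num.min z.1 z.2) @^-1` F1 `&`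
                        (fun z : R * R => z.1 - z.2) @^-1` F2).
    apply: measurableI.
      refine (measurable_preimage _ mF1).
      by apply: measurable_minr; [exact: measurable_fst|exact: measurable_snd].
    refine (measurable_preimage _ mF2).
    by apply: measurable_funB; [exact: measurable_fst|exact: measurable_snd].
  by rewrite [in RHS]setIC; exact: (indep_joint _ _ mF mQ).
(* [Q] describes the updated increments when evaluated at [(W, D)], and the old pair [(I, J)] when
   evaluated at [(M, D)]. *)
pose Q := (fun z : R * R => z.1 + Num.max z.2 0) @^-1` B `&`
          (fun z : R * R => z.1 + Num.max (- z.2) 0) @^-1` C.
have mQ : measurable Q.
  have mp1 := @measurable_fst _ _ R R.
  have mp2 := @measurable_snd _ _ R R.
  apply: measurableI.
    refine (measurable_preimage _ mB); apply: measurable_funD => //.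
    exact: measurable_maxr.
  refine (measurable_preimage _ mC); apply: measurable_funD => //.
  by apply: measurable_maxr => //; exact: measurable_funN.
(* [W] and [M] have the same law and are independent of each other, of [D] and of [E], so they may
   be exchanged; hence the weight one. *)
have swap := @eq_restricted_law_prod _ _ _ P _ _ _ _ (NngNum (@ler01 R))
  (E `&` M @^-1` A) (E `&` W @^-1` A) W M D D.
rewrite -indepE// -[RHS]mul1e.
transitivity (1%:E * P ((E `&` W @^-1` A) `&`
  [set t | Q (M t, D t)]))%E.
  apply: (swap _ _ _ _ _ _ _ Q) => //.
  - by apply: measurableI => //; exact: mpre.
  - by apply: measurableI => //; exact: mpre.
  move=> F1 F2 mF1 mF2; rewrite /= mul1e indep_WMD//.
  have -> : E `&` M @^-1` A `&` (W @^-1` F1 `&` D @^-1` F2) =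
            E `&` W @^-1` F1 `&` (M @^-1` A `&` D @^-1` F2).
    by rewrite setIACA [M @^-1` A `&` _]setIC setIACA.
  by rewrite indep_WMD// -!muleA; congr (_ * _)%E; rewrite muleCA.
congr (_ * P (_ `&` _))%E.
have IE t : M t + Num.max (D t) 0 = I t.
  by rewrite /M /D /Num.min /Num.max; case: ltP => ?; case: ltP => ?; lra.
have JE t : M t + Num.max (- D t) 0 = J t.
  by rewrite /M /D /Num.min /Num.max; case: ltP => ?; case: ltP => ?; lra.
by apply/seteqP; split => t; rewrite /Q /= IE JE.
Qed.

End corner.

(** * Independent families: enlarging, reindexing, updating *)

Section independent_families.
Context d (T : measurableType d) (R : realType) (P : probability T R).

(** Indices added to [F] with the whole line as their set change neither the intersection nor the
    product. So only finite sets containing a fixed [G], later the three updated indices, need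
    checking. *)
Lemma mutually_independent_superset (K : choiceType) (X : K -> T -> R)
    (G : {fset K}) :
  (forall k, measurable_fun [set: T] (X k)) ->
  (forall (F : {fset K}) (A : K -> set R), (G `<=` F)%fset ->
    (forall k, measurable (A k)) ->
    P (\bigcap_(k in [set` F]) (X k @^-1` A k)) =
    (\prod_(k <- F) P (X k @^-1` A k))%E) ->
  mutually_independent P setT X.
Proof.
move=> mX H; split=> [k _|F A _ mA]; first exact: mX.
pose A' k := if k \in F then A k else setT.
have := H (F `|` G)%fset A' (fsubsetUr _ _).
have -> : \bigcap_(k in [set` (F `|` G)%fset]) (X k @^-1` A' k) =
          \bigcap_(k in [set` F]) (X k @^-1` A k).
  apply/seteqP; split => t H' k /= kF.
    by have := H' k; rewrite /= inE kF /A' kF; exact.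
  by rewrite /A'; case: ifPn => // kF'; exact: H'.
rewrite -(@big_fset_incl _ _ _ _ F); last 2 first.
- exact: fsubsetUl.
- by move=> k _ kF; rewrite /A' (negbTE kF) preimage_setT probability_setT.
move=> ->; last first.
  by move=> k; rewrite /A'; case: ifPn => // /mA.
by apply: eq_fbigr => k kF _; rewrite /A' kF.
Qed.

(** Independence concerns only finite subfamilies, so [X] and [f] may depend on [F]; this lets a
    finite piece of an infinite path be compared with a finite diagram. *)
Lemma mutually_independent_reindex (K L : choiceType) (C : set K) (D : set L)
    (Y : L -> T -> R) :
  (forall F : {fset L}, [set` F] `<=` D ->
    exists (X : K -> T -> R) (f : L -> K), [/\ mutually_independent P C X,
      {in F &, injective f} & forall l, l \in F -> C (f l) /\ Y l = X (f l)]) ->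
  mutually_independent P D Y.
Proof.
move=> reindex; split=> [l Dl|F A FD mA].
  have [l'|X [f [[mX _] _ Yf]]] := reindex [fset l]%fset.
    by rewrite /= inE => /eqP ->.
  by have [|Cfl ->] := Yf l; rewrite ?inE//; exact: mX.
have [X [f [[_ indep] f_inj CYf]]] := reindex F FD.
have Yf l : l \in F -> Y l = X (f l) by move=> /CYf[].
(* By injectivity the fibre of [f l] in [F] is [l] alone; off the image the fibre is empty and the
   set is the whole line. *)
pose A' k := \bigcap_(l in [set l | l \in F /\ f l = k]) A l.
have A'f l : l \in F -> A' (f l) = A l.
  move=> lF; apply/seteqP; split => x; first by apply; split.
  by move=> Ax l' [/= l'F /f_inj ->].
have fFC : [set` (f @` F)%fset] `<=` C.
  by move=> _ /imfsetP[l /= /CYf[? _] ->].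
have := indep (f @` F)%fset A' fFC.
rewrite big_imfset//= => H.
rewrite [RHS](_ : _ = \prod_(l <- F) P (X (f l) @^-1` A' (f l)))%E; last first.
  by apply: eq_fbigr => l lF _; rewrite Yf// A'f.
rewrite -H; last by move=> _ /imfsetP[l /= lF ->]; rewrite A'f//; exact: mA.
congr (P _); apply/seteqP; split => t /= h.
  by move=> _ /imfsetP[l /= lF ->]; rewrite A'f// -Yf//; exact: h.
move=> l /= lF; have := h (f l); rewrite A'f// -Yf//; apply.
by apply/imfsetP; exists l.
Qed.

Definition independent_exp (K : choiceType) (X : K -> T -> R)
    (lambda : K -> R) :=
  mutually_independent P setT X /\
  forall k, exp_distributed P (X k) (lambda k).

(** The minimum of two independent exponentials has the sum of their rates, so the rate condition
    makes every index keep its rate and updates can be iterated. *)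
Lemma independent_exp_update (K : choiceType) (X X' : K -> T -> R)
    (lambda : K -> R) (k1 k2 k3 : K) :
  k1 != k2 -> k1 != k3 -> k2 != k3 -> lambda k1 = lambda k2 + lambda k3 ->
  (forall t, X' k1 t = Num.min (X k2 t) (X k3 t)) ->
  (forall t, X' k2 t = X k1 t + Num.max (X k2 t - X k3 t) 0) ->
  (forall t, X' k3 t = X k1 t + Num.max (- (X k2 t - X k3 t)) 0) ->
  (forall k, k != k1 -> k != k2 -> k != k3 -> X' k = X k) ->
  independent_exp X lambda -> independent_exp X' lambda.
Proof.
move=> k12 k13 k23 lambda1 X'1 X'2 X'3 X'E [[mX indep] Xexp].
have {}mX k : measurable_fun [set: T] (X k) by exact: mX.
have mX' k : measurable_fun [set: T] (X' k).
  have [->|kk1] := eqVneq k k1.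
    by rewrite (funext X'1); exact: measurable_minr.
  have mD : measurable_fun [set: T] (fun t => X k2 t - X k3 t).
    exact: measurable_funB.
  have [->|kk2] := eqVneq k k2.
    rewrite (funext X'2); apply: measurable_funD => //.
    exact: measurable_maxr.
  have [->|kk3] := eqVneq k k3; last by rewrite X'E.
  rewrite (funext X'3); apply: measurable_funD => //.
  by apply: measurable_maxr => //; exact: measurable_funN.
have bigcapE (F : {fset K}) (Y : K -> set T) : k1 \in F -> k2 \in F -> k3 \in F ->
    \bigcap_(k in [set` F]) Y k =
    (\bigcap_(k in [set` (F `\ k1 `\ k2 `\ k3)%fset]) Y k `&` Y k1) `&`
    (Y k2 `&` Y k3).
  move=> F1 F2 F3; apply/seteqP; split => t.
    move=> h; split; split; try exact: h.
    by move=> k /=; rewrite !inE => /andP[_ /andP[_ /andP[_ kF]]]; exact: h.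
  move=> [[h h1] [h2 h3]] k /= kF.
  have [->//|kk1] := eqVneq k k1; have [->//|kk2] := eqVneq k k2.
  by have [->//|kk3] := eqVneq k k3; apply: h; rewrite /= !inE kk1 kk2 kk3.
have prodE (F : {fset K}) (y : K -> \bar R) : k1 \in F -> k2 \in F -> k3 \in F ->
    (\prod_(k <- F) y k =
    (\prod_(k <- (F `\ k1 `\ k2 `\ k3)%fset) y k) * y k1 * (y k2 * y k3))%E.
  move=> F1 F2 F3; rewrite (big_fsetD1 k1)//= (big_fsetD1 k2)/=; last first.
    by rewrite !inE F2 eq_sym k12.
  rewrite (big_fsetD1 k3)/=; last by rewrite !inE F3 eq_sym k23 eq_sym k13.
  by rewrite [(y k2 * (y k3 * _))%E]muleA [(y k2 * y k3 * _)%E]muleC muleA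
    [(y k1 * _)%E]muleC.
pose F3 := [fset k1; k2; k3]%fset.
have indepE (F : {fset K}) A : (F3 `<=` F)%fset -> (forall k, measurable (A k)) ->
    forall B1 B2 B3, measurable B1 -> measurable B2 -> measurable B3 ->
    P ((\bigcap_(k in [set` (F `\ k1 `\ k2 `\ k3)%fset]) (X k @^-1` A k) `&`
        X k1 @^-1` B1) `&` (X k2 @^-1` B2 `&` X k3 @^-1` B3)) =
    (P (\bigcap_(k in [set` (F `\ k1 `\ k2 `\ k3)%fset]) (X k @^-1` A k)) *
     P (X k1 @^-1` B1) * (P (X k2 @^-1` B2) * P (X k3 @^-1` B3)))%E.
  move=> /fsubsetP F3F mA B1 B2 B3 mB1 mB2 mB3.
  have [F1 F2 F3'] : [/\ k1 \in F, k2 \in F & k3 \in F].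
    by split; apply: F3F; rewrite !inE eqxx ?orbT.
  pose B k := if k == k1 then B1 else if k == k2 then B2 else
              if k == k3 then B3 else A k.
  have [b1 b2 b3] : [/\ B k1 = B1, B k2 = B2 & B k3 = B3].
    by rewrite /B !eqxx [k2 == k1]eq_sym [k3 == k1]eq_sym [k3 == k2]eq_sym
      (negbTE k12) (negbTE k13) (negbTE k23).
  have bA k : k \in (F `\ k1 `\ k2 `\ k3)%fset -> B k = A k.
    by rewrite !inE /B => /andP[/negbTE-> /andP[/negbTE-> /andP[/negbTE->]]].
  have := indep F B (@subsetT _ _).
  rewrite bigcapE// prodE// b1 b2 b3 => H.
  rewrite (indep (F `\ k1 `\ k2 `\ k3)%fset)//.
  under eq_bigcapr do rewrite -bA//.
  rewrite H; last by move=> k _; rewrite /B; do 3?case: ifP.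
  by congr (_ * _ * _)%E; apply: eq_fbigr => k kF _; rewrite bA.
have indep23 A B : measurable A -> measurable B ->
    P (X k2 @^-1` A `&` X k3 @^-1` B) = (P (X k2 @^-1` A) * P (X k3 @^-1` B))%E.
  move=> mA mB; have := indepE F3 (fun=> setT) (fsubset_refl _) (fun=> measurableT)
    _ _ _ measurableT mA mB.
  rewrite preimage_setT (_ : \bigcap_(k in _) _ = setT); last first.
    by apply/seteqP; split.
  by rewrite !setTI probability_setT !mul1e.
have mE (F : {fset K}) A : (forall k, measurable (A k)) ->
    measurable (\bigcap_(k in [set` F]) (X k @^-1` A k)).
  move=> mA; apply: fin_bigcap_measurable => // k _.
  exact: measurable_preimage.
have update (F : {fset K}) A : (F3 `<=` F)%fset -> (forall k, measurable (A k)) ->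
    forall B1 B2 B3, measurable B1 -> measurable B2 -> measurable B3 ->
    P ((\bigcap_(k in [set` (F `\ k1 `\ k2 `\ k3)%fset]) (X k @^-1` A k) `&`
        X' k1 @^-1` B1) `&` (X' k2 @^-1` B2 `&` X' k3 @^-1` B3)) =
    (P (\bigcap_(k in [set` (F `\ k1 `\ k2 `\ k3)%fset]) (X k @^-1` A k)) *
     P (X k1 @^-1` B1) * (P (X k2 @^-1` B2) * P (X k3 @^-1` B3)))%E.
  move=> F3F mA B1 B2 B3 mB1 mB2 mB3.
  have W := Xexp k1; rewrite lambda1 in W.
  rewrite (funext X'1) (funext X'2) (funext X'3).
  apply: (corner_update _ W (Xexp k2) (Xexp k3)) => //; first exact: mE.
  by move=> ? ? ? ? ? ?; exact: indepE.
(* At an updated index, the marginal comes from the joint identity with the whole line at the other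
   two. *)
have lawE k A : measurable A -> P (X' k @^-1` A) = P (X k @^-1` A).
  move=> mA.
  have upd := @update F3 (fun=> setT) (fsubset_refl _) (fun=> measurableT).
  have T1 : \bigcap_(k in [set` (F3 `\ k1 `\ k2 `\ k3)%fset]) (X k @^-1` setT) = setT.
    by apply/seteqP; split.
  have [->|kk1] := eqVneq k k1.
    have := upd _ _ _ mA measurableT measurableT.
    by rewrite T1 !preimage_setT !setTI !setIT probability_setT !mul1e !mule1.
  have [->|kk2] := eqVneq k k2.
    have := upd _ _ _ measurableT mA measurableT.
    by rewrite T1 !preimage_setT !setTI !setIT probability_setT !mul1e !mule1.
  have [->|kk3] := eqVneq k k3; last by rewrite X'E.
  have := upd _ _ _ measurableT measurableT mA.
  by rewrite T1 !preimage_setT !setTI probability_setT !mul1e.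
split; last first.
  move=> k; split=> // A mA; rewrite /pushforward lawE//.
  exact: (Xexp k).2.
apply: (@mutually_independent_superset _ _ F3) => // F A F3F mA.
have [F1 F2 F3'] : [/\ k1 \in F, k2 \in F & k3 \in F].
  by split; apply: (fsubsetP F3F); rewrite !inE eqxx ?orbT.
rewrite bigcapE// prodE// !lawE//.
have -> : \bigcap_(k in [set` (F `\ k1 `\ k2 `\ k3)%fset]) (X' k @^-1` A k) =
          \bigcap_(k in [set` (F `\ k1 `\ k2 `\ k3)%fset]) (X k @^-1` A k).
  apply: eq_bigcapr => k /=; rewrite !inE.
  by move=> /andP[? /andP[? /andP[? _]]]; rewrite X'E.
rewrite update// indep//; congr (_ * _ * _)%E.
by apply: eq_fbigr => k kF _; rewrite lawE.
Qed.

End independent_families.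

(** * Counting in down-closed sets, and lattice coordinates relative to [u] *)

Lemma ltn_count_down_closed (Q : nat -> bool) (n b : nat) :
  (forall i j, (i <= j)%N -> Q j -> Q i) ->
  (b < \sum_(i < n) Q i)%N = (b < n)%N && Q b.
Proof.
move=> Qdown; elim: n => [|n IH]; first by rewrite big_ord0.
(* If [Q n] holds, down-closedness makes every smaller index count as well, so the sum is full;
   otherwise nothing is added. *)
rewrite big_ord_recr/=; have [Qn|Qn] := boolP (Q n); last first.
  rewrite addn0 IH ltnS [(b <= n)%N]leq_eqVlt.
  by have [->|//] := eqVneq b n; rewrite (negbTE Qn) !andbF.
rewrite (eq_bigr (fun=> 1%N)); last first.
  by move=> i _; rewrite (Qdown _ _ (ltnW (ltn_ord i)) Qn).
rewrite sum1_card card_ord addn1; have [bn|//] := ltnP b n.+1.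
by rewrite (Qdown b n bn Qn).
Qed.

Lemma ltn_ext (m n : nat) : (forall b, (b < m)%N = (b < n)%N) -> m = n.
Proof.
move=> H; apply/eqP; rewrite eqn_leq [(m <= n)%N]leqNgt [(n <= m)%N]leqNgt.
by rewrite H ltnn -H ltnn.
Qed.

Definition grid (u : site) (a b : nat) : site := (u.1 + a%:Z, u.2 + b%:Z).

Lemma grid_eqP (u x : site) a b :
  x = grid u a b <-> x.1 = u.1 + a%:Z /\ x.2 = u.2 + b%:Z.
Proof.
by case: x => x1 x2; split=> [[-> ->]//|/= [-> ->]].
Qed.

Lemma grid_ge (u x : site) : quadrant_ge u x ->
  x = grid u `|x.1 - u.1|%N `|x.2 - u.2|%N.
Proof. by case: u x => [u1 u2] [x1 x2] [/= h1 h2]; apply/grid_eqP => /=; lia. Qed.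

Lemma grid_gt (u x : site) : quadrant_gt u x ->
  x = grid u `|x.1 - u.1|.-1.+1 `|x.2 - u.2|.-1.+1.
Proof. by case: u x => [u1 u2] [x1 x2] [/= h1 h2]; apply/grid_eqP => /=; lia. Qed.

Lemma quadrant_gt_grid u a b : quadrant_gt u (grid u a.+1 b.+1).
Proof. by case: u => u1 u2; split => /=; lia. Qed.

Lemma grid_subs_e1 u a b : grid u a.+1 b - e1 = grid u a b.
Proof. by case: u => u1 u2; apply/grid_eqP => /=; lia. Qed.

Lemma grid_subs_e2 u a b : grid u a b.+1 - e2 = grid u a b.
Proof. by case: u => u1 u2; apply/grid_eqP => /=; lia. Qed.

Lemma addr_e1Mn (x : site) n : x + e1 *+ n = (x.1 + n%:Z, x.2).
Proof.
elim: n => [|n IH]; first by case: x => x1 x2; rewrite mulr0n addr0 /= addr0.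
by rewrite mulrS addrCA IH /e1; apply/eqP; rewrite xpair_eqE/=; lia.
Qed.

Lemma addr_e2Mn (x : site) n : x + e2 *+ n = (x.1, x.2 + n%:Z).
Proof.
elim: n => [|n IH]; first by case: x => x1 x2; rewrite mulr0n addr0 /= addr0.
by rewrite mulrS addrCA IH /e2; apply/eqP; rewrite xpair_eqE/=; lia.
Qed.

Lemma grid_axis1 u n : u + e1 *+ n = grid u n 0.
Proof. by rewrite addr_e1Mn /grid addr0. Qed.

Lemma grid_axis2 u n : u + e2 *+ n = grid u 0 n.
Proof. by rewrite addr_e2Mn /grid addr0. Qed.

Lemma diagMn n : (e1 + e2) *+ n = (n%:Z, n%:Z) :> site.
Proof.
by rewrite mulrnDl -[e1 *+ n]add0r addr_e1Mn addr_e2Mn /= !add0r.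
Qed.

(** * Growing Young diagrams square by square *)

Section staircase.
Context d (T : measurableType d) (R : realType) (P : probability T R).
Variables (u : site) (rho : R) (omega I J comega : site -> T -> R).

(* The family along the boundary of a Young diagram whose column [a] has
   height [h a] and whose row [b] has length [w b]: the index (a, b) stands for
   the unit square with corners [grid u a b] and [grid u a.+1 b.+1], which
   carries comega if it lies in the diagram and omega otherwise; column [a]
   carries the horizontal boundary edge and row [b] the vertical one. *)
Definition staircase_var (h w : nat -> nat) (k : (nat * nat) + (nat + nat)) :
    T -> R :=
  match k with
  | inl ab => if (ab.2 < h ab.1)%N then comega (grid u ab.1 ab.2)
              else omega (grid u ab.1.+1 ab.2.+1)
  | inr (inl a) => I (grid u a.+1 (h a))
  | inr (inr b) => J (grid u (w b) b.+1)
  end.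

Definition staircase_rate (k : (nat * nat) + (nat + nat)) : R :=
  match k with
  | inl _ => 1
  | inr (inl _) => 1 - rho
  | inr (inr _) => rho
  end.

Hypotheses
  (input_indep : mutually_independent P (input_index u) (input_var omega I J u))
  (omega_exp : forall x, quadrant_gt u x -> exp_distributed P (omega x) 1)
  (I_exp : forall i : nat, (0 < i)%N ->
     exp_distributed P (I (u + e1 *+ i)) (1 - rho))
  (J_exp : forall j : nat, (0 < j)%N -> exp_distributed P (J (u + e2 *+ j)) rho)
  (recursion : increment_recursion u omega I J comega).

Let indep_staircase h w :=
  independent_exp P (staircase_var h w) staircase_rate.

(** For the empty diagram every square carries [omega] and the boundary is the pair of axes, so this
    is the input family under another indexing. *)
Lemma staircase_axes : indep_staircase (fun=> 0%N) (fun=> 0%N).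
Proof.
split; last first.
  case=> [[a b]|[a|b]] /=.
  - exact/omega_exp/quadrant_gt_grid.
  - by rewrite -grid_axis1; exact: I_exp.
  - by rewrite -grid_axis2; exact: J_exp.
apply: (mutually_independent_reindex (C := input_index u)) => F _;
 exists (input_var omega I J u).
exists (fun k => match k with
  | inl ab => inl (grid u ab.1.+1 ab.2.+1)
  | inr (inl a) => inr (inl a.+1)
  | inr (inr b) => inr (inr b.+1)
  end); split=> //.
  move=> [[a b]|[a|b]] [[a' b']|[a'|b']] _ _ //=; last 2 first.
  - by move=> [->].
  - by move=> [->].
  by move=> [] /addrI[->] /addrI[->].
move=> [[a b]|[a|b]] _; split=> //=.
- exact: quadrant_gt_grid.
- by rewrite grid_axis1.
- by rewrite grid_axis2.
Qed.

(** By [h a = b] and [w b = a] the bottom and left edges of the square [(a, b)] lie on the boundary.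
    The recursion trades them for its top and right edges, and [omega] for [comega]; the rates fit
    since [1 = (1 - rho) + rho]. *)
Lemma staircase_add_square h w h' w' a b : h a = b -> w b = a ->
  h' a = b.+1 -> w' b = a.+1 ->
  (forall a', a' != a -> h' a' = h a') -> (forall b', b' != b -> w' b' = w b') ->
  indep_staircase h w -> indep_staircase h' w'.
Proof.
move=> ha wb h'a w'b h'E w'E.
have x_gt := quadrant_gt_grid u a b.
apply: (independent_exp_update (k1 := inl (a, b)) (k2 := inr (inl a))
  (k3 := inr (inr b))) => //=.
- by rewrite subrK.
- move=> t; rewrite h'a ltnSn ha wb -(grid_subs_e1 u a b).
  rewrite -(grid_subs_e2 u a.+1 b) addrAC (comega_rec recursion x_gt).
  by rewrite grid_subs_e1 grid_subs_e2.
- move=> t; rewrite h'a ha wb ltnn (I_rec recursion x_gt).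
  by rewrite grid_subs_e1 grid_subs_e2.
- move=> t; rewrite w'b ha wb ltnn (J_rec recursion x_gt).
  by rewrite grid_subs_e1 grid_subs_e2.
move=> [[a' b']|[a'|b']] /= k1 k2 k3; last 2 first.
- by rewrite h'E.
- by rewrite w'E.
have [aa'|aa'] := eqVneq a' a; last by rewrite h'E.
rewrite aa' h'a ha ltnS leq_eqVlt; case: eqVneq => // bb'.
by rewrite aa' bb' eqxx in k1.
Qed.

(* Squares are added column by column, from bottom to top. *)
Lemma staircase_partial (h : nat -> nat) (c r : nat) :
  {homo h : i j / (i <= j)%N >-> (j <= i)%N} -> (r <= h c)%N ->
  indep_staircase (fun a => if (a < c)%N then h a else if a == c then r else 0)
    (fun b => \sum_(i < c) (b < h i) + (b < r))%N.
Proof.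
move=> hmono.
pose H c r a := if (a < c)%N then h a else if a == c then r else 0%N.
pose W c r b := (\sum_(i < c) (b < h i) + (b < r))%N.
(* Earlier columns are at least as high as column [m], so row [n] has length exactly [m] and the
   square [(m, n)] can be added. *)
have step m n : (n < h m)%N ->
    indep_staircase (H m n) (W m n) -> indep_staircase (H m n.+1) (W m n.+1).
  move=> nh; apply: (staircase_add_square (a := m) (b := n)).
  - by rewrite /H ltnn eqxx.
  - rewrite /W ltnn addn0 (eq_bigr (fun=> 1%N)) ?sum1_card ?card_ord// => i _.
    by rewrite (leq_trans nh)// hmono// ltnW.
  - by rewrite /H ltnn eqxx.
  - rewrite /W ltnSn (eq_bigr (fun=> 1%N)) ?sum1_card ?card_ord ?addn1// => i _.
    by rewrite (leq_trans nh)// hmono// ltnW.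
  - by move=> a /negbTE; rewrite /H => ->.
  - by move=> b bn; rewrite /W ltnS leq_eqVlt (negbTE bn).
rewrite -/(H c r) -/(W c r); elim: c r => [|c IHc]; elim=> [|r IHr] rh.
- have := staircase_axes; congr indep_staircase.
    by apply/funext => a; rewrite /H; case: eqP.
  by apply/funext => b; rewrite /W big_ord0.
- by apply: step => //; apply: IHr; exact: ltnW.
(* A completed column [c] followed by an empty column [c.+1] is the same diagram. *)
- have := IHc _ (leqnn _); congr indep_staircase.
    apply/funext => a; rewrite /H ltnS [(a <= c)%N]leq_eqVlt.
    by case: eqVneq => [->|_]; [rewrite ltnn|case: ifP => //; case: ifP].
  by apply/funext => b; rewrite /W big_ord_recr/= addn0.
- by apply: step => //; apply: IHr; exact: ltnW.
Qed.

Lemma staircase_independent (h : nat -> nat) (n : nat) :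
  {homo h : i j / (i <= j)%N >-> (j <= i)%N} ->
  indep_staircase (fun a => if (a < n)%N then h a else 0%N)
                  (fun b => \sum_(i < n) (b < h i))%N.
Proof.
move=> hmono; have := staircase_partial hmono (leq0n (h n)).
congr indep_staircase; apply/funext => a.
  by case: ifP => // _; case: eqP.
by rewrite addn0.
Qed.

(** The edge lies on the top side of a rectangle of height [m], whose family has the required
    marginals. The next two lemmas use the right side and the interior of a rectangle. *)
Lemma I_grid_exp a m : exp_distributed P (I (grid u a.+1 m)) (1 - rho).
Proof.
have [|_ /(_ (inr (inl a)))] := @staircase_independent (fun=> m) a.+1; first by [].
by rewrite /= ltnSn.
Qed.

Lemma J_grid_exp m b : exp_distributed P (J (grid u m b.+1)) rho.
Proof.
have [|_ /(_ (inr (inr b)))] := @staircase_independent (fun=> b.+1) m; first by [].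
rewrite /= (eq_bigr (fun=> 1%N)) ?sum1_card ?card_ord// => i _.
by rewrite ltnSn.
Qed.

Lemma comega_grid_exp a b : exp_distributed P (comega (grid u a b)) 1.
Proof.
have [|_ /(_ (inl (a, b)))] := @staircase_independent (fun=> b.+1) a.+1; first by [].
by rewrite /= !ltnSn.
Qed.

End staircase.

(** * Geometry of a down-right path *)

Section path.
Context (u : site) (y : int -> site).
Hypothesis yP : down_right_path u y.

Lemma path_step (k : int) :
  (y k).1 = (y (k - 1)).1 + 1 /\ (y k).2 = (y (k - 1)).2 \/
  (y k).1 = (y (k - 1)).1 /\ (y k).2 = (y (k - 1)).2 - 1.
Proof.
have [_] := yP k; case: (y k) (y (k - 1)) => [a1 a2] [b1 b2] /=.
by case=> -[h1 h2]; [left|right]; lia.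
Qed.

Lemma path_monotone (k l : int) : k <= l ->
  (y k).1 <= (y l).1 /\ (y l).2 <= (y k).2.
Proof.
move=> kl; have -> : l = k + `|l - k|%N%:Z by lia.
elim: `|l - k|%N => [|n [IH1 IH2]]; first by rewrite addr0.
have := path_step (k + n.+1%:Z); have -> : k + n.+1%:Z - 1 = k + n%:Z by lia.
by lia.
Qed.

(** Applied to the lower left corner of a unit square, it says that the square lies under the path.
    Unlike the diagonal condition of [below_path], it is visibly down-closed. *)
Definition strictly_below (x : site) : bool :=
  `[< exists k, x.1 < (y k).1 /\ x.2 < (y k).2 >].

(** Later path points are no higher than [y k] and earlier ones no further right, so none exceeds
    [x] in both coordinates. *)
Lemma strictly_below_path k (x : site) :
  (y k).1 <= x.1 -> (y k).2 <= x.2 -> strictly_below x = false.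
Proof.
move=> h1 h2; apply/asboolP => -[l [l1 l2]].
by case: (leP k l) => [|/ltW] /path_monotone; lia.
Qed.

Lemma below_path_grid x : below_path u y x ->
  strictly_below (grid u `|x.1 - u.1|%N `|x.2 - u.2|%N).
Proof.
move=> [xu [j [j0 [k _ yk]]]]; rewrite -grid_ge//.
by apply/asboolP; exists k; rewrite yk diagMn /=; lia.
Qed.

Lemma above_path_gt x : above_path u y x -> quadrant_gt u x.
Proof.
move=> [xu [j [j0 [k _ yk]]]]; have [[]] := yP k.
by rewrite yk diagMn /quadrant_gt /= => ? ? _; lia.
Qed.

(** The predecessors lead to the lower left corner of the square carrying [omega x]. The diagonal
    shift is at least one, so a path point is still weakly south-west of that corner. *)
Lemma above_path_grid x : above_path u y x ->
  strictly_below (grid u `|x.1 - u.1|.-1 `|x.2 - u.2|.-1) = false.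
Proof.
move=> xa; have := above_path_gt xa; case: xa => [xu [j [j0 [k _ yk]]]] [x1 x2].
by apply: (@strictly_below_path k); rewrite yk diagMn /=; lia.
Qed.

(** Sites of this column below the edge are dominated by its right end [y k]; the others lie weakly
    north-east of its left end. Hence the edge gives the column height. *)
Lemma horizontal_edge (k : int) : (y k).1 = (y (k - 1)).1 + 1 ->
  y k = grid u `|(y (k - 1)).1 - u.1|.+1 `|(y k).2 - u.2| /\
  forall b, strictly_below (grid u `|(y (k - 1)).1 - u.1| b) =
            (b < `|(y k).2 - u.2|)%N.
Proof.
have below b x := @strictly_below_path (k - 1) (grid u x b).
have above b x (lt1 : (grid u x b).1 < (y k).1) (lt2 : (grid u x b).2 < (y k).2) :
    strictly_below (grid u x b) by apply/asboolP; exists k.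
move: below above (yP k).1 (yP (k - 1)).1 (path_step k).
case: (y k) (y (k - 1)) => [p1 p2] [q1 q2]; rewrite /quadrant_ge /= => below above.
move=> [? ?] [? ?] ? ?; split; first by apply/grid_eqP => /=; lia.
by move=> b; have [?|?] := ltnP b; [apply: above|apply: below]; lia.
Qed.

(** Transpose of the horizontal case; the step goes down, so the upper end, which indexes [J], is
    [y (k - 1)]. *)
Lemma vertical_edge (k : int) : (y k).1 = (y (k - 1)).1 ->
  y (k - 1) = grid u `|(y k).1 - u.1| `|(y k).2 - u.2|.+1 /\
  forall a, strictly_below (grid u a `|(y k).2 - u.2|) =
            (a < `|(y k).1 - u.1|)%N.
Proof.
have below a x := @strictly_below_path k (grid u a x).
have above a x (lt1 : (grid u a x).1 < (y (k - 1)).1)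
    (lt2 : (grid u a x).2 < (y (k - 1)).2) :
    strictly_below (grid u a x) by apply/asboolP; exists (k - 1).
move: below above (yP k).1 (yP (k - 1)).1 (path_step k).
case: (y k) (y (k - 1)) => [p1 p2] [q1 q2]; rewrite /quadrant_ge /= => below above.
move=> [? ?] [? ?] ? ?; split; first by apply/grid_eqP => /=; lia.
by move=> a; have [?|?] := ltnP a; [apply: above|apply: below]; lia.
Qed.

Lemma edge_varE (T : Type) (R : realType) (I J : site -> T -> R) (k : int) :
  edge_var I J (y (k - 1)) (y k) =
  if (y k).1 == (y (k - 1)).1 + 1 then I (y k) else J (y (k - 1)).
Proof.
have := path_step k; rewrite /edge_var.
case: (y k) (y (k - 1)) => [a1 a2] [b1 b2] /=; rewrite !xpair_eqE /=.
move=> [[-> ->]|[-> ->]]; first by rewrite addr0 !eqxx.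
have -> : (b1 == b1 + 1) = false by lia.
have -> : (b2 - 1 == b2 + 1) = false by lia.
by rewrite andbF subrK !addr0 !eqxx.
Qed.

End path.

(** * Independence along a path *)

Section path_independence.
Context d (T : measurableType d) (R : realType) (P : probability T R).
Variables (u : site) (omega I J comega : site -> T -> R) (y : int -> site).
Hypothesis yP : down_right_path u y.

(** [comega] is named by the lower left corner of its square and [omega] by the upper right one,
    hence the predecessors in the last case. A horizontal edge is identified by its column, a
    vertical one by its row. *)
Definition staircase_index (k : site + (int + site)) :
    (nat * nat) + (nat + nat) :=
  match k with
  | inl z => inl (`|z.1 - u.1|%N, `|z.2 - u.2|%N)
  | inr (inl k) =>
      if (y k).1 == (y (k - 1)).1 + 1 then inr (inl `|(y (k - 1)).1 - u.1|%N)
      else inr (inr `|(y k).2 - u.2|%N)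
  | inr (inr x) => inl (`|x.1 - u.1|.-1, `|x.2 - u.2|.-1)
  end.

(** No square is both under and above the path, and by monotonicity the path crosses each column and
    each row at most once. *)
Lemma staircase_index_inj :
  {in path_index u y &, injective staircase_index}.
Proof.
have cross z x : below_path u y z -> above_path u y x ->
    (`|z.1 - u.1|%N, `|z.2 - u.2|%N) <> (`|x.1 - u.1|.-1, `|x.2 - u.2|.-1).
  move=> /below_path_grid + /(above_path_grid yP) nb [h1 h2].
  by rewrite h1 h2 nb.
have horizontal_lt (k l : int) : k < l -> (y k).1 = (y (k - 1)).1 + 1 ->
    (y (k - 1)).1 < (y (l - 1)).1.
  move=> kl h; have /(path_monotone yP)[] : k <= l - 1 by lia.
  by rewrite h; lia.
have vertical_lt (k l : int) : k < l -> (y l).1 <> (y (l - 1)).1 + 1 ->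
    (y l).2 < (y k).2.
  move=> kl h; have /(path_monotone yP)[_] : k <= l - 1 by lia.
  by case: (path_step yP l) => [[]//|[_ ->]]; lia.
have ge k : u.1 <= (y k).1 /\ u.2 <= (y k).2 := (yP k).1.
move=> [z|[k|x]] [z'|[k'|x']]; rewrite !inE /= => h h'; try by case: ifP.
- move=> [h1 h2]; congr inl.
  by rewrite (grid_ge h.1) (grid_ge h'.1) h1 h2.
- by move=> [h1 h2]; have := cross _ _ h h'; rewrite h1 h2.
- case: ifPn => /eqP e; case: ifPn => /eqP e' // -[eq_idx];
    congr (inr (inl _)).
    have {}eq_idx : (y (k - 1)).1 = (y (k' - 1)).1.
      by move: (ge (k - 1)).1 (ge (k' - 1)).1 eq_idx; lia.
    have [kk'|kk'|//] := ltgtP k k'.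
      by have := horizontal_lt _ _ kk' e; rewrite eq_idx ltxx.
    by have := horizontal_lt _ _ kk' e'; rewrite eq_idx ltxx.
  have {}eq_idx : (y k).2 = (y k').2.
    by move: (ge k).2 (ge k').2 eq_idx; lia.
  have [kk'|kk'|//] := ltgtP k k'.
    by have := vertical_lt _ _ kk' e'; rewrite eq_idx ltxx.
  by have := vertical_lt _ _ kk' e; rewrite eq_idx ltxx.
- by move=> [h1 h2]; have := cross _ _ h' h; rewrite h1 h2.
- move=> [h1 h2]; congr (inr (inr _)).
  rewrite (grid_gt (above_path_gt yP h)) (grid_gt (above_path_gt yP h')).
  by rewrite h1 h2.
Qed.

Lemma mutually_independent_path :
  (forall (h : nat -> nat) n, {homo h : i j / (i <= j)%N >-> (j <= i)%N} ->
    mutually_independent P setT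
      (staircase_var u omega I J comega
        (fun a => if (a < n)%N then h a else 0%N)
        (fun b => \sum_(i < n) (b < h i))%N)) ->
  mutually_independent P (path_index u y) (path_var omega I J comega y).
Proof.
move=> indep; apply: (mutually_independent_reindex (C := setT)) => F FD.
pose size (x : site) := (`|x.1 - u.1| + `|x.2 - u.2|)%N.
pose corner (l : site + (int + site)) : site :=
  match l with inl z => z | inr (inl k) => y k | inr (inr x) => x end.
(* [n] exceeds both coordinates, relative to [u], of every site that [corner] attaches to [F], so
   cutting at [n] affects none of these variables. *)
pose n := (\max_(l <- F) size (corner l)).+1.
have ltn l : l \in F -> (size (corner l) < n)%N.
  by move=> lF; rewrite ltnS (big_fsetD1 l)//= leq_maxl.
pose h a := (\sum_(b < n) strictly_below y (grid u a b))%N.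
have below_down a a' b b' : (a' <= a)%N -> (b' <= b)%N ->
    strictly_below y (grid u a b) -> strictly_below y (grid u a' b').
  move=> aa bb /asboolP[k [/= h1 h2]]; apply/asboolP; exists k => /=; lia.
have hE a b : (b < h a)%N = (b < n)%N && strictly_below y (grid u a b).
  apply: (@ltn_count_down_closed (fun b => strictly_below y (grid u a b))) => i j.
  exact: below_down.
have h_mono : {homo h : i j / (i <= j)%N >-> (j <= i)%N}.
  move=> i j ij; apply: leq_sum => b _.
  have := @below_down _ _ b b ij (leqnn _).
  by case: strictly_below => // ->.
exists (staircase_var u omega I J comega
        (fun a => if (a < n)%N then h a else 0%N)
        (fun b => \sum_(i < n) (b < h i))%N), staircase_index.
split; first exact: indep.
  by move=> l l' /FD Dl /FD Dl'; apply: staircase_index_inj; rewrite inE.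
move=> l lF; split=> //; have := ltn l lF; have := FD _ lF; rewrite /size.
case: l {lF} => [z|[k|x]] /= lD sz.
- rewrite (_ : (_ < _)%N = true); first by rewrite -(grid_ge lD.1).
  rewrite (_ : (_ < n)%N = true); last by lia.
  by rewrite hE below_path_grid// andbT; lia.
- rewrite (edge_varE yP); have [hk|vk] := eqVneq.
    have [yE below] := horizontal_edge yP hk.
    have an : (`|((y (k - 1)).1 - u.1)%R|%N < n)%N.
      by move: (yP k).1 (yP (k - 1)).1 hk sz; rewrite /quadrant_ge/=; lia.
    rewrite /= an (_ : h _ = `|(y k).2 - u.2|%N) -?yE//.
    (* The edge is lower than [n], so the cut leaves the height of its column intact. *)
    apply: ltn_ext => b; rewrite hE below.
    by apply/andb_idl => bm; rewrite (leq_trans bm)//; move: sz; lia.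
  have vk' : (y k).1 = (y (k - 1)).1.
    by have [[/eqP]|[]//] := path_step yP k; rewrite (negbTE vk).
  have [yE below] := vertical_edge yP vk'.
  have bn : (`|((y k).2 - u.2)%R|%N < n)%N by move: sz; lia.
  rewrite /= (_ : (\sum_(_ < _) _)%N = `|(y k).1 - u.1|%N) -?yE//.
  apply: ltn_ext => a.
  rewrite (@ltn_count_down_closed (fun i => (_ < h i)%N)); last first.
    by move=> i j ij; rewrite !hE => /andP[->]; exact: below_down.
  rewrite hE bn below.
  by apply/andb_idl => am; rewrite (leq_trans am)//; move: sz; lia.
- rewrite (_ : (_ < _)%N = false); first by rewrite -(grid_gt (above_path_gt yP lD)).
  by case: ifP => // _; rewrite hE (above_path_grid yP)// andbF.
Qed.

End path_independence.

(** * Increments of the last-passage process *)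

Section last_passage_increments.
Context (T : Type) (R : realType) (u : site)
  (omega I J comega G : site -> T -> R).
Hypotheses (rec : increment_recursion u omega I J comega)
  (lp : last_passage u omega I J G).

(** Inductively [I (x - e2) - J (x - e1)] equals [G (x - e2) - G (x - e1)]. Its positive part is the
    maximum of these two values of [G] minus [G (x - e1)], its negative part the maximum minus
    [G (x - e2)]; adding [omega x] gives the increments at [x]. *)
Lemma last_passage_increments a b t :
  I (grid u a.+1 b) t = G (grid u a.+1 b) t - G (grid u a b) t /\
  J (grid u a b.+1) t = G (grid u a b.+1) t - G (grid u a b) t.
Proof.
have I0 i : I (grid u i.+1 0) t = G (grid u i.+1 0) t - G (grid u i 0) t.
  rewrite -!grid_axis1 !(lp_axis1 lp) [in RHS]big_nat_recr//=.
  by rewrite addrAC subrr add0r.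
have J0 j : J (grid u 0 j.+1) t = G (grid u 0 j.+1) t - G (grid u 0 j) t.
  rewrite -!grid_axis2 !(lp_axis2 lp) [in RHS]big_nat_recr//=.
  by rewrite addrAC subrr add0r.
have bulk i j :
    I (grid u i.+1 j) t = G (grid u i.+1 j) t - G (grid u i j) t ->
    J (grid u i j.+1) t = G (grid u i j.+1) t - G (grid u i j) t ->
    I (grid u i.+1 j.+1) t = G (grid u i.+1 j.+1) t - G (grid u i j.+1) t /\
    J (grid u i.+1 j.+1) t = G (grid u i.+1 j.+1) t - G (grid u i.+1 j) t.
  move=> Iij Jij; have x_gt := quadrant_gt_grid u i j.
  rewrite (I_rec rec x_gt) (J_rec rec x_gt) (lp_bulk lp x_gt).
  rewrite !grid_subs_e1 !grid_subs_e2 Iij Jij /Num.max.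
  by split; do 2?[case: ltP => ?]; lra.
(* The horizontal increments of row [j] yield the vertical ones above it from left to right, and
   these yield the horizontal ones of row [j.+1]. *)
have rowJ j : (forall i,
      I (grid u i.+1 j) t = G (grid u i.+1 j) t - G (grid u i j) t) ->
    forall i, J (grid u i j.+1) t = G (grid u i j.+1) t - G (grid u i j) t.
  by move=> Ij; elim=> [//|i IH]; exact: (bulk _ _ (Ij i) IH).2.
have rowI j i : I (grid u i.+1 j) t = G (grid u i.+1 j) t - G (grid u i j) t.
  elim: j i => [//|j IH] i.
  exact: (bulk _ _ (IH i) (rowJ _ IH _)).1.
by split; [exact: rowI|apply: rowJ => i; exact: rowI].
Qed.

End last_passage_increments.

(** * Burke property: independence along paths, marginal laws and increments *)

Theorem theorem3p1 (d : measure_display) (T : measurableType d) (R : realType)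
    (P : probability T R) (u : site) (rho : R)
    (omega I J comega : site -> T -> R)
    (rho_gt0 : 0 < rho) (rho_lt1 : rho < 1)
    (input_indep :
       mutually_independent P (input_index u) (input_var omega I J u))
    (omega_exp : forall x, quadrant_gt u x -> exp_distributed P (omega x) 1)
    (I_exp : forall i : nat, (0 < i)%N ->
       exp_distributed P (I (u + e1 *+ i)) (1 - rho))
    (J_exp : forall j : nat, (0 < j)%N ->
       exp_distributed P (J (u + e2 *+ j)) rho)
    (recursion : increment_recursion u omega I J comega) :
  ((forall y : int -> site, down_right_path u y ->
      mutually_independent P (path_index u y) (path_var omega I J comega y)) /\
   (forall x, quadrant_gt u x -> exp_distributed P (omega x) 1) /\
   (forall x, quadrant_ge u x -> exp_distributed P (comega x) 1) /\
   (forall x : site, u.1 < x.1 -> u.2 <= x.2 ->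
      exp_distributed P (I x) (1 - rho)) /\
   (forall x : site, u.1 <= x.1 -> u.2 < x.2 ->
      exp_distributed P (J x) rho)) /\
  (forall G : site -> T -> R, last_passage u omega I J G ->
    (forall x : site, u.1 < x.1 -> u.2 <= x.2 ->
       forall t, I x t = G x t - G (x - e1) t) /\
    (forall x : site, u.1 <= x.1 -> u.2 < x.2 ->
       forall t, J x t = G x t - G (x - e2) t)).
Proof.
have indep := staircase_independent input_indep omega_exp I_exp J_exp recursion.
have xE x : u.1 <= x.1 -> u.2 <= x.2 -> x = grid u `|x.1 - u.1| `|x.2 - u.2|.
  by move=> h1 h2; exact: grid_ge.
have x1E x : u.1 < x.1 -> u.2 <= x.2 ->
    exists a b, x = grid u a.+1 b.
  move=> h1 h2; exists `|x.1 - u.1|.-1, `|x.2 - u.2|%N.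
  by rewrite {1}(xE x (ltW h1) h2); congr (grid u _ _); move: h1; lia.
have x2E x : u.1 <= x.1 -> u.2 < x.2 ->
    exists a b, x = grid u a b.+1.
  move=> h1 h2; exists `|x.1 - u.1|%N, `|x.2 - u.2|.-1.
  by rewrite {1}(xE x h1 (ltW h2)); congr (grid u _ _); move: h2; lia.
split; last first.
  move=> G lp; split=> x h1 h2 t.
    have [a [b ->]] := x1E _ h1 h2.
    by rewrite grid_subs_e1; have [] := last_passage_increments recursion lp a b t.
  have [a [b ->]] := x2E _ h1 h2.
  by rewrite grid_subs_e2; have [] := last_passage_increments recursion lp a b t.
split.
  by move=> y yP; apply: mutually_independent_path => // h n /indep -/(_ n)[].
split; first exact: omega_exp.
split.
  by move=> x /grid_ge ->;
     exact: (comega_grid_exp input_indep omega_exp I_exp J_exp recursion).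
split=> x h1 h2.
  by have [a [b ->]] := x1E _ h1 h2;
    exact: (I_grid_exp input_indep omega_exp I_exp J_exp recursion).
by have [a [b ->]] := x2E _ h1 h2;
  exact: (J_grid_exp input_indep omega_exp I_exp J_exp recursion).
Qed.
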